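(* Let $X$ be a compact Hausdorff space. If $(X,f)$ is a minimal dynamical system then it exhibits the strong orbital shadowing property.
   Context: A dynamical system is a pair $(X,f)$ with $X$ a (nonempty) compact Hausdorff space and $f\colon X\to X$ a continuous function. A compact Hausdorff space has a unique uniformity $\mathscr{U}$ inducing its topology. Since symmetric entourages form a base for $\mathscr{U}$, all entourages referred to are taken to be symmetric ($E=E^{-1}$). For $E\in\mathscr{U}$, $x\in X$ and $A\subseteq X$: $B_E(x)=\{y\in X \mid (x,y)\in E\}$ and $B_E(A)=\bigcup_{x\in A}B_E(x)$. For $D\in\mathscr{U}$, a $D$-pseudo-orbit is a sequence $(x_i)_{i\ge 0}$ in $X$ with $(f(x_i),x_{i+1})\in D$ for all $i\ge 0$. A subset $A\subseteq X$ is positively invariant if $f(A)\subseteq A$. The system $(X,f)$ is minimal if there are no proper, nonempty, closed, positively invariant subsets of $X$; equivalently, if $\omega(x)=X$ for all $x\in X$, where $\omega(x)=\bigcap_{N\in\mathbb{N}}\overline{\{f^n(x)\mid n>N\}}$. The system $(X,f)$ has the strong orbital shadowing property if for all $E\in\mathscr{U}$ there exists $D\in\mathscr{U}$ such that for any $D$-pseudo-orbit $(x_i)_{i\ge 0}$ there exists a point $z\in X$ such that, for all $N\in\mathbb{N}_0=\{0,1,2,\ldots\}$, \[\{f^{N+i}(z)\}_{i\ge 0}\subseteq B_E\left(\{x_{N+i}\}_{i\ge 0}\right)\quad\text{and}\quad \{x_{N+i}\}_{i\ge 0}\subseteq B_E\left(\{f^{N+i}(z)\}_{i\ge 0}\right).\]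 *)

(* Defs.v *)
From HB Require Import structures.
From mathcomp Require Import all_boot all_order all_algebra.
From mathcomp Require Import all_classical topology.

Set Implicit Arguments.
Unset Strict Implicit.
Unset Printing Implicit Defensive.

Local Open Scope classical_set_scope.
Local Open Scope relation_scope.

(* A compact Hausdorff space carries exactly one uniformity inducing its
   topology, so it is represented as a [uniformType] that is compact and
   Hausdorff: [entourage] is then that uniformity. *)

Definition sym_entourage (X : uniformType) (E : set (X * X)) : Prop :=
  entourage E /\ E^-1 = E.

(* [xsection E x] is the ball B_E(x) = {y | (x, y) \in E}. *)
Definition ent_ball (X : Type) (E : set (X * X)) (A : set X) : set X :=
  \bigcup_(x in A) xsection E x.

Definition positively_invariant (X : Type) (f : X -> X) (A : set X) : Prop :=
  f @` A `<=` A.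

Definition minimal_system (X : topologicalType) (f : X -> X) : Prop :=
  ~ exists A : set X,
      [/\ A `<` [set: X], A !=set0, closed A & positively_invariant f A].

Definition pseudo_orbit (X : Type) (f : X -> X) (D : set (X * X))
    (x : nat -> X) : Prop :=
  forall i : nat, D (f (x i), x i.+1).

Definition tail (X : Type) (u : nat -> X) (N : nat) : set X :=
  range (fun i : nat => u (N + i)).

Definition orbit_seq (X : Type) (f : X -> X) (z : X) : nat -> X :=
  fun n => iter n f z.

Definition strong_orbital_shadowing (X : uniformType) (f : X -> X) : Prop :=
  forall E : set (X * X), sym_entourage E ->
  exists2 D : set (X * X), sym_entourage D &
    forall x : nat -> X, pseudo_orbit f D x ->
    exists z : X, forall N : nat,
      tail (orbit_seq f z) N `<=` ent_ball E (tail x N) /\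
      tail x N `<=` ent_ball E (tail (orbit_seq f z) N).

(* Main.v *)
Require Import Defs.
From mathcomp Require Import all_boot all_order all_algebra.
From mathcomp Require Import all_classical topology.

Local Open Scope classical_set_scope.

(** In a minimal system every forward orbit is dense, since its closure is a
nonempty closed positively invariant set ([minimal_orbit_dense]).  So for any
[z], every tail of its orbit, being the orbit of an iterate of [z], comes
[E]-close to every point of [X]; this settles the second inclusion of strong
orbital shadowing.

The first inclusion follows from the fact that, for [D] small enough, every
[D]-pseudo-orbit comes [E]-close to every point of [X]
([minimal_pseudo_orbit_ent_dense]): this applies to the tails as well, which
are themselves [D]-pseudo-orbits.  To prove it, let [U] be a nonempty open set
and [w] a point.  Some iterate [f^k w] lies in [U], and by continuity all
[D]-pseudo-orbits starting near [w] are in [U] at time [k], once [D] is small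
([pseudo_orbit_iter_near]).  Compactness makes [D] independent of [w]
([minimal_pseudo_orbit_meets_open]).  Taking for [U] a small neighbourhood of
a point [y], a second use of compactness makes [D] independent of [y].

As any point [z] whatsoever shadows, the pseudo-orbit itself plays no role in
the choice of [z]. *)

(** A condition on a point and a member of a filter that is inherited by
smaller members, and that can be met near each point of a compact set, can be
met by one member at all points of the set. *)
Lemma compact_uniform_filter {T : topologicalType} {Y : Type}
    (F : set_system Y) (K : set T) (Q : set Y -> T -> Prop) :
  Filter F -> compact K ->
  (forall A B y, B `<=` A -> Q A y -> Q B y) ->
  (forall y, K y -> exists2 A, F A & \forall w \near y, Q A w) ->
  exists2 A, F A & forall y, K y -> Q A y.
Proof.
move=> FF cK anti loc.
(* The filter of the properties shared by all small enough members of [F]. *)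
pose G : set_system (set Y) := filter_from F (fun A => [set B | B `<=` A]).
have GF : Filter G.
  apply: filter_from_filter; first by exists setT; exact: filterT.
  move=> A B FA FB; exists (A `&` B); first exact: filterI.
  by move=> C /=; rewrite subsetI.
have [A FA AQ] : \forall A \near G, K `<=` Q A.
  apply: (compact_near_coveringP K).1 => // y /loc[A FA nQ].
  exists ([set w | Q A w], [set B | B `<=` A]).
    by split => //=; exists A.
  by move=> [w B] /= [QAw BA]; exact: anti QAw.
by exists A => // y; apply: AQ => /=.
Qed.

Lemma pseudo_orbitS {X : Type} (f : X -> X) (A B : set (X * X)) x :
  B `<=` A -> pseudo_orbit f B x -> pseudo_orbit f A x.
Proof. by move=> BA Bx i; exact/BA/Bx. Qed.

Lemma pseudo_orbit_shift {X : Type} (f : X -> X) (D : set (X * X)) x n :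
  pseudo_orbit f D x -> pseudo_orbit f D (fun i => x (n + i)).
Proof. by move=> Dx i; rewrite addnS; exact: Dx. Qed.

Lemma tail_orbit_seq {X : Type} (f : X -> X) z n :
  tail (orbit_seq f z) n = range (orbit_seq f (iter n f z)).
Proof.
by apply: eq_imagel => i _; rewrite /orbit_seq addnC iterD.
Qed.

Lemma minimal_orbit_dense {X : topologicalType} (f : X -> X) z :
  continuous f -> minimal_system f -> closure (range (orbit_seq f z)) = setT.
Proof.
move=> cf fmin; apply: contrapT => ndense; apply: fmin.
exists (closure (range (orbit_seq f z))); split.
- by rewrite properEneq; split => //; exact/eqP.
- by exists z; apply: subset_closure; exists 0.
- exact: closed_closure.
- move=> _ [y cly <-] B /cf /cly[_ [[i _ <-] Bi]].
  by exists (f (orbit_seq f z i)); split => //; exists i.+1.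
Qed.

Lemma pseudo_orbit_iter_near {X : uniformType} (f : X -> X) k w (U : set X) :
  continuous f -> nbhs (iter k f w) U ->
  exists2 D, entourage D & \forall w' \near w,
    forall x, pseudo_orbit f D x -> x 0 = w' -> U (x k).
Proof.
move=> cf; elim: k w => [|k IH] w nU.
  exists setT; first exact: filterT.
  by apply: filterS nU => w' Uw' x _ ->.
have [|D eD nD] := IH (f w); first by rewrite -iterSr.
have [V eV VU] : filter_from entourage (fun V => xsection V (f w))
    [set w' | forall x, pseudo_orbit f D x -> x 0 = w' -> U (x k)].
  by rewrite filter_from_entourageE.
(* The point [x 1] is one half of [V] away from [f (x 0)], which for [x 0]
   near [w] is the other half of [V] away from [f w]. *)
exists (D `&` split_ent V).
  by apply: filterI => //; exact: entourage_split_ent.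
have : \forall w' \near w, xsection (split_ent V) (f w) (f w').
  by apply: cf; apply: nbhs_entourage; exact: entourage_split_ent.
apply: filterS => w' /xsectionP Vw' x Dx x0.
have Vx1 : xsection V (f w) (x 1).
  apply/xsectionP; apply: entourage_split Vw' _ => //.
  by have [_] := Dx 0; rewrite x0.
apply: (VU _ Vx1 (fun i => x (1 + i))) => //.
apply: pseudo_orbit_shift.
by apply: pseudo_orbitS Dx; exact: subIsetl.
Qed.

Lemma minimal_pseudo_orbit_meets_open {X : uniformType} (f : X -> X)
    (U : set X) :
  compact [set: X] -> continuous f -> minimal_system f ->
  open U -> U !=set0 ->
  exists2 D, entourage D & forall x, pseudo_orbit f D x -> exists k, U (x k).
Proof.
move=> cX cf fmin oU [u Uu].
have [|w _|D eD DU] := @compact_uniform_filter X (X * X) entourage setT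
    (fun D w => forall x, pseudo_orbit f D x -> x 0 = w -> exists k, U (x k))
    _ cX.
- move=> A B w BA AU x Bx; apply: AU; exact: pseudo_orbitS Bx.
- have : closure (range (orbit_seq f w)) u by rewrite minimal_orbit_dense.
  move=> /(_ U (open_nbhs_nbhs (conj oU Uu)))[_ [[k _ <-] Uk]].
  have [|D eD nD] := @pseudo_orbit_iter_near X f k w U cf.
    exact: open_nbhs_nbhs.
  exists D => //; apply: filterS nD => w' DU x Dx x0.
  by exists k; exact: DU x0.
- by exists D => // x Dx; exact: (DU (x 0)).
Qed.

Lemma minimal_pseudo_orbit_ent_dense {X : uniformType} (f : X -> X)
    (E : set (X * X)) :
  compact [set: X] -> continuous f -> minimal_system f -> entourage E ->
  exists2 D, entourage D &
    forall y x, pseudo_orbit f D x -> exists k, E (x k, y).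
Proof.
move=> cX cf fmin eE.
have [|y _|D eD DE] := @compact_uniform_filter X (X * X) entourage setT
    (fun D y => forall x, pseudo_orbit f D x -> exists k, E (x k, y)) _ cX.
- move=> A B y BA AE x Bx; apply: AE; exact: pseudo_orbitS Bx.
- have eS := entourage_split_ent eE.
  have nS : nbhs y (xsection ((split_ent E)^-1)%relation y).
    by apply: nbhs_entourage; exact: entourage_inv.
  have [|D eD DU] := minimal_pseudo_orbit_meets_open f
      (interior (xsection ((split_ent E)^-1)%relation y))
      cX cf fmin (open_interior _).
    by exists y.
  exists D => //; apply: filterS (nbhs_entourage y eS) => w /xsectionP Sw x Dx.
  have [k /interior_subset /xsectionP Sk] := DU x Dx.
  by exists k; exact: entourage_split Sk Sw.
- by exists D => // y; exact: DE.
Qed.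

Theorem corollary2p7 (X : uniformType) (f : X -> X)
  (X_nonempty : [set: X] !=set0)
  (X_compact : compact [set: X])
  (X_hausdorff : hausdorff_space X)
  (f_continuous : continuous f)
  (f_minimal : minimal_system f) :
  strong_orbital_shadowing f.
Proof.
move=> E [eE Esym].
have [D eD DE] :=
  minimal_pseudo_orbit_ent_dense f E X_compact f_continuous f_minimal eE.
exists (D `&` D^-1)%relation.
  split; first by apply: filterI => //; exact: entourage_inv.
  by apply/seteqP; split => -[a b] [].
have [z _] := X_nonempty => x Dx; exists z => N; split => y.
- have /(DE y)[k Ek] : pseudo_orbit f D (fun i => x (N + i)).
    apply: pseudo_orbit_shift.
    by apply: pseudo_orbitS Dx; exact: subIsetl.
  move=> _; exists (x (N + k)); first by exists k.
  exact/xsectionP.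
- move=> _; rewrite tail_orbit_seq.
  have : closure (range (orbit_seq f (iter N f z))) y.
    by rewrite minimal_orbit_dense.
  move=> /(_ _ (nbhs_entourage y eE))[t [Ot /xsectionP Eyt]].
  exists t => //; apply/xsectionP.
  by rewrite -Esym.
Qed.
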